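(* Let $S$ be a ring and $R$ a subring of $S$ which is an integral domain contained in the center of $S$; assume that $S$ is a free $R$-module of finite rank $n$. Let $\widetilde G$ be a closed subgroup of $\operatorname{GL}(n,\overline{k})$, $G'=\widetilde G(R)=\widetilde G\cap \operatorname{GL}(n,R)$, and $T'=T\cap G'$. Assume that $S$ is additively generated by its invertible elements and that the group $\operatorname{Aut}(S/R)$ of ring automorphisms of $S$ that are the identity on $R$ is finite. Assume also that every element of $\overline{T}$ is a $\overline{k}$-linear combination of elements of the connected component (of the identity) of $\overline{T'}$. Then the lower garland of the lattice $\mathrm{Lat}(T',G')$ coincides with the interval $\mathrm{Lat}(T',N_{G'}(T'))$.
   Context: Rings are associative with unit, subrings are unitary. Fix an $R$-basis $\omega_1,\dots,\omega_n$ of $S$. For $\alpha\in S$ let $t(\alpha)=(t_{ij}(\alpha))\in M(n,R)$ be given by $\omega_i\alpha=\sum_{j=1}^n t_{ji}(\alpha)\omega_j$. Put $T=t(S^* )\leqslant\operatorname{GL}(n,R)$. Let $k$ be the quotient field of $R$ and $\overline{k}$ its algebraic closure. For a subgroup $X\leqslant \operatorname{GL}(n,\overline{k})$, $\overline{X}$ denotes its Zariski closure in $\operatorname{GL}(n,\overline{k})$. For groups $A\leqslant B$, $\mathrm{Lat}(A,B)=\{H: A\leqslant H\leqslant B\}$ is the lattice of intermediate subgroups. Its normality graph has the intermediate subgroups as vertices, two of them being joined by an edge iff one of them is normal in the other. A garland is a connected component of the normality graph; the lower garland is the one containing $A$. $N_{G'}(\cdot)$ is the normalizer in $G'$. *)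

(* Defs.v *)
From HB Require Import structures.
From Stdlib Require Import Relation_Operators.
From mathcomp Require Import all_boot all_order all_algebra.
From mathcomp Require Import boolp classical_sets functions cardinality.
From mathcomp Require Import topology.
From mathcomp.multinomials Require Import mpoly.

Set Implicit Arguments.
Unset Strict Implicit.
Unset Printing Implicit Defensive.

Import GRing.Theory.
Local Open Scope classical_set_scope.
Local Open Scope ring_scope.

Section Groups.
Variable G : groupType.
Implicit Types A B F H : set G.
Local Open Scope group_scope.

Definition subgroup H : Prop :=
  H 1 /\ forall x y, H x -> H y -> H (x * y^-1).

Definition normal_in H F : Prop :=
  H `<=` F /\ forall x g, H x -> F g -> H (x ^ g).

Definition normalizer F H : set G :=
  [set g | F g /\ [set x ^ g | x in H] = H].

Definition Lat A B : set (set G) :=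
  [set H | [/\ subgroup H, A `<=` H & H `<=` B]].

Definition normality_edge A B H F : Prop :=
  [/\ Lat A B H, Lat A B F & normal_in H F \/ normal_in F H].

(* [normality_edge] is symmetric, so its reflexive transitive closure is
   connectedness in the graph. *)
Definition garland A B H : set (set G) :=
  [set F | Lat A B F /\ clos_refl_trans _ (normality_edge A B) H F].

Definition lower_garland A B : set (set G) := garland A B A.

End Groups.

(* [{'GL_n[R]}] is only available for finite rings [R]. *)
Section GeneralLinear.
Variables (n : nat) (R : comUnitRingType).

Record GL : Type := GL_of_mx { GL_mx : 'M[R]_n; GL_unitmx : GL_mx \in unitmx }.

HB.instance Definition _ := [isSub for GL_mx].
HB.instance Definition _ := [Choice of GL by <:].

Let mulGL_subproof (g h : GL) : GL_mx g *m GL_mx h \in unitmx.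
Proof. by rewrite unitmx_mul !GL_unitmx. Qed.

Let oneGL_subproof : (1%:M : 'M[R]_n) \in unitmx.
Proof. exact: unitmx1. Qed.

Let invGL_subproof (g : GL) : invmx (GL_mx g) \in unitmx.
Proof. by rewrite unitmx_inv GL_unitmx. Qed.

Definition mulGL (g h : GL) : GL := GL_of_mx (mulGL_subproof g h).
Definition oneGL : GL := GL_of_mx oneGL_subproof.
Definition invGL (g : GL) : GL := GL_of_mx (invGL_subproof g).

Let mulGLA : associative mulGL.
Proof. by move=> x y z; apply: val_inj; rewrite /= mulmxA. Qed.

Let mul1GL : left_id oneGL mulGL.
Proof. by move=> x; apply: val_inj; rewrite /= mul1mx. Qed.

Let mulGL1 : right_id oneGL mulGL.
Proof. by move=> x; apply: val_inj; rewrite /= mulmx1. Qed.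

Let mulVGL : left_inverse oneGL invGL mulGL.
Proof. by move=> x; apply: val_inj; rewrite /= mulVmx ?GL_unitmx. Qed.

Let mulGLV : right_inverse oneGL invGL mulGL.
Proof. by move=> x; apply: val_inj; rewrite /= mulmxV ?GL_unitmx. Qed.

HB.instance Definition _ :=
  isGroup.Build GL mulGLA mul1GL mulGL1 mulVGL mulGLV.

End GeneralLinear.

Section MapGL.
Variables (n : nat) (R K : comUnitRingType) (f : {rmorphism R -> K}).

Let mapGL_subproof (g : GL n R) : map_mx f (GL_mx g) \in unitmx.
Proof. by rewrite unitmxE det_map_mx rmorph_unit // -unitmxE GL_unitmx. Qed.

Definition mapGL (g : GL n R) : GL n K := GL_of_mx (mapGL_subproof g).

End MapGL.

(* The Zariski topology on GL(n,K), as a subspace of the affine space of n x n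
   matrices: the closed sets are the zero loci in GL(n,K) of the sets of
   polynomials in the n * n matrix entries (1/det is not needed, since a power
   of det clears it from an equation). *)
Section Zariski.
Variables (n : nat) (K : fieldType).

Definition evalGL (p : {mpoly K[n * n]}) (g : GL n K) : K :=
  p.@[fun k => mxvec (GL_mx g) 0 k].

Definition zero_locus (P : set ({mpoly K[n * n]})) : set (GL n K) :=
  [set g | forall p, P p -> evalGL p g = 0].

Definition zariski_open : set_system (GL n K) :=
  [set U | exists P, ~` U = zero_locus P].

Let zariski_openT : zariski_open setT.
Proof.
exists [set 1]; rewrite setCT; apply/esym/seteqP; split=> // g.
by move=> /(_ _ erefl)/eqP; rewrite /evalGL meval1 oner_eq0.
Qed.

Let zariski_openI : setI_closed zariski_open.
Proof.
move=> U V [P UP] [Q VQ]; exists [set p * q | p in P & q in Q].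
rewrite setCI UP VQ; apply/seteqP; split=> [g|g PQg].
  case=> Zg r [p Pp [q Qq <-]]; rewrite /evalGL mevalM.
    by move: (Zg p Pp); rewrite /evalGL => ->; rewrite mul0r.
  by move: (Zg q Qq); rewrite /evalGL => ->; rewrite mulr0.
have [Pg|/existsNP[p /not_implyP[Pp /eqP pg]]] := pselect (zero_locus P g).
  by left.
right=> q Qq; have /eqP : evalGL (p * q) g = 0.
  by apply: PQg; exists p => //; exists q.
by rewrite /evalGL mevalM mulf_eq0 (negPf pg) => /eqP.
Qed.

Let zariski_open_bigU (I : Type) (f : I -> set (GL n K)) :
  (forall i, zariski_open (f i)) -> zariski_open (\bigcup_i f i).
Proof.
move=> /choice[P fP]; exists (\bigcup_i P i).
rewrite setC_bigcup; apply/seteqP; split=> [g fg p [i _ Pp]|g Pg i _].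
  by have := fg i Logic.I; rewrite fP; apply.
by rewrite fP => p Pp; apply: Pg; exists i.
Qed.

HB.instance Definition _ := isOpenTopological.Build (GL n K)
  zariski_openT zariski_openI zariski_open_bigU.

Lemma zariski_closedP (A : set (GL n K)) :
  closed A <-> exists P, A = zero_locus P.
Proof.
by rewrite -openC; split=> -[P]; rewrite ?setCK => ?; exists P; rewrite ?setCK.
Qed.

End Zariski.

Definition is_basis (R : nzRingType) (M : lmodType R) n (omega : 'I_n -> M) :
    Prop :=
  forall x, exists! c : 'rV[R]_n, x = \sum_j c 0 j *: omega j.

Definition additively_generated_by_units (S : unitRingType) : Prop :=
  forall A : set S, A 0 -> (forall x y, A x -> A y -> A (x - y)) ->
    (forall u, u \is a GRing.unit -> A u) -> forall x, A x.

Definition Aut_over (R : comNzRingType) (S : algType R) : set (S -> S) :=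
  [set f | [/\ bijective f, zmod_morphism f, GRing.monoid_morphism f
             & forall r : R, f r%:A = r%:A]].
Arguments Aut_over {R} S.

(* Main.v *)
From HB Require Import structures.
Require Import Defs.
From Stdlib Require Import Relation_Operators.
From mathcomp Require Import all_boot all_order all_algebra.
From mathcomp Require Import boolp classical_sets functions cardinality.
From mathcomp Require Import topology.
From mathcomp.multinomials Require Import mpoly.

Set Implicit Arguments.
Unset Strict Implicit.
Unset Printing Implicit Defensive.

Import GRing.Theory.
Local Open Scope classical_set_scope.
Local Open Scope ring_scope.

(** Write [c] for coordinate columns with respect to [omega], so that [t alpha]
    is the matrix of right multiplication by [alpha] and [t] is an injective
    ring anti-homomorphism. Let [C] be the identity component of the closure
    of [T'].  Each [t u] with [u] a unit lies in the linear span of [C], and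
    units generate [S], so a linear condition that holds on [C] holds on all
    of [t S] ([t_linear_vanish]). Everything rests on the fact that linear
    conditions are Zariski closed, hence pass from [T'] to its closure.

    An [h] normalizing [T'] normalizes [t S]: membership in [t S] is a linear
    condition, and it holds on the conjugates of [T'] ([conj_t]). So [h]
    induces an automorphism of [S] over [R], one of finitely many
    ([normalizer_aut]).

    The garland can only leave the interval through a step from some [H]
    between [T'] and its normalizer to an overgroup [F] in which [H] is normal
    ([lower_garland_eq]). For [g] in [F] the conjugates [x ^ g], with [x] in
    [T'], lie in [H] and hence normalize [T']. Sorting the [x] by the
    automorphism that [x ^ g] induces covers [T'], and then its closure, by
    finitely many disjoint closed sets; the connected set [C] stays in the
    piece of the identity automorphism. Thus the conjugates of [C] by [g]
    commute with [t S], and so do those of [t S] ([conj_t_comm]). For [g = 1]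
    this says that [S] is commutative. Then [t S] is its own commutant, so [g]
    normalizes [t S], therefore the group of units of [t S], and therefore
    [T'] ([normal_overgroup]). *)

(** * Normalizers and the lower garland *)

Section Subgroups.
Variable G : groupType.
Implicit Types H F : set G.
Local Open Scope group_scope.

Lemma subgroupV H x : subgroup H -> H x -> H x^-1.
Proof. by case=> H1 HM Hx; rewrite -[x^-1]mul1g; apply: HM. Qed.

Lemma subgroupM H x y : subgroup H -> H x -> H y -> H (x * y).
Proof.
by move=> sH Hx Hy; rewrite -[y]invgK; apply: sH.2 => //; apply: subgroupV.
Qed.

Lemma subgroupJ H x y : subgroup H -> H x -> H y -> H (x ^ y).
Proof.
move=> sH Hx Hy; apply: subgroupM => //; first exact: subgroupV.
exact: subgroupM.
Qed.

(** Stability of [H] under all of [F] gives more than inclusion: the inverse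
    of [g] also maps [H] into itself, so conjugation by [g] is onto. *)
Lemma conj_sub_normalizer F H g : subgroup F -> F g ->
  (forall h x, F h -> H x -> H (x ^ h)) -> normalizer F H g.
Proof.
move=> sF Fg nH; split=> //; apply/seteqP; split=> [_ [x Hx <-]|x Hx].
  exact: nH.
exists (x ^ g^-1); last by rewrite conjgKV.
by apply: nH => //; apply: subgroupV.
Qed.

Lemma normalizer_conj F H g x : normalizer F H g -> H x -> H (x ^ g).
Proof. by case=> _ defH Hx; rewrite -defH; exists x. Qed.

Lemma normalizer_conjV F H g x : normalizer F H g -> H x -> H (x ^ g^-1).
Proof. by case=> _ {1}<- [y Hy <-]; rewrite conjgK. Qed.

(** Along a path in the normality graph a descending edge stays below the
    normalizer, so only the ascending edges have to be controlled. In the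
    other direction, every group in the interval is adjacent to [A]. *)
Lemma lower_garland_eq A B : subgroup A -> A `<=` B ->
  (forall H F, Lat A (normalizer B A) H -> Lat A B F -> normal_in H F ->
     F `<=` normalizer B A) ->
  lower_garland A B = Lat A (normalizer B A).
Proof.
move=> sA sAB up; apply/seteqP; split=> F.
  case=> _ path.
  have step H F' : normality_edge A B H F' ->
      Lat A (normalizer B A) H -> Lat A (normalizer B A) F'.
    case=> LH LF [nHF|nFH] NH; case: (LF) => sF AF FB; split=> //.
      exact: up NH LF nHF.
    by case: NH => _ _; apply: subset_trans; case: nFH.
  have NA : Lat A (normalizer B A) A.
    split=> // g Ag; split; first exact: sAB.
    by case: (@conj_sub_normalizer A A g sA Ag) => // h x ? ?; apply: subgroupJ.
  have steps H F' : clos_refl_trans _ (normality_edge A B) H F' ->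
      Lat A (normalizer B A) H -> Lat A (normalizer B A) F'.
    by elim=> {H F'} [H F' /step|//|? ? ? _ IH1 _ IH2 /IH1/IH2].
  exact: steps path NA.
case=> sF AF FN; have FB : F `<=` B by move=> x /FN[].
split; first by split.
apply: Relation_Operators.rt_step; split; [by split| by split|left].
by split=> // x g Ax Fg; apply: normalizer_conj Ax; apply: FN.
Qed.

End Subgroups.

(** * Connected sets and Zariski-closed linear conditions *)

Lemma closure_sub (T : topologicalType) (A Z : set T) :
  closed Z -> A `<=` Z -> closure A `<=` Z.
Proof. by move=> clZ AZ; apply: subset_trans (closureS AZ) clZ. Qed.

(** A piece of a finite partition into closed sets is also relatively open,
    its complement being the finite union of the others. *)
Lemma connected_sub_piece (T : topologicalType) (I : choiceType) (D : set I)
    (Z : I -> set T) (A : set T) (i0 : I) (a : T) :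
  finite_set D -> (forall i, closed (Z i)) ->
  (forall i j x, Z i x -> Z j x -> i = j) ->
  connected A -> A `<=` \bigcup_(i in D) Z i -> A a -> Z i0 a -> A `<=` Z i0.
Proof.
move=> finD clZ disjZ cA AZ Aa Za; rewrite -setIidPl; apply: cA.
- by exists a.
- exists (~` \bigcup_(i in D `\ i0) Z i).
    rewrite openC; apply: closed_bigcup => //.
    exact: sub_finite_set finD.
  apply/seteqP; split=> x [Ax Zx]; split=> //.
    by case=> i [_ /= ii0] Zix; apply: ii0; apply: disjZ Zix Zx.
  have [i Di Zix] := AZ x Ax; have [<-//|ii0] := pselect (i = i0).
  by case: Zx; exists i.
- by exists (Z i0).
Qed.

(** Lets the theory of bundled linear maps apply to explicit formulas. *)
Lemma linear_bundle (K : pzRingType) (U V : lmodType K) (f : U -> V) :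
  linear f -> exists F : {linear U -> V}, f = F.
Proof.
move=> lf; pose F : {linear U -> V} :=
  HB.pack f (GRing.isLinear.Build _ _ _ _ _ lf).
by exists F.
Qed.

(** Every entry of [f M] is a linear form in the entries of [M], that is a
    polynomial of degree at most one. *)
Lemma closed_linear (K : fieldType) n p q (f : 'M[K]_n -> 'M[K]_(p, q)) :
  linear f -> closed [set g : GL n K | f (GL_mx g) = 0].
Proof.
case/linear_bundle=> F ->.
pose P i j : {mpoly K[n * n]} := \sum_k F (vec_mx (delta_mx 0 k)) i j *: 'X_k.
have evalP g i j : evalGL (P i j) g = F (GL_mx g) i j.
  rewrite /evalGL raddf_sum -[in RHS](mxvecK (GL_mx g)).
  rewrite [in RHS](row_sum_delta (mxvec _)) !linear_sum summxE.
  by apply: eq_bigr => k _; rewrite /= mevalZ mevalXU !linearZ mxE mulrC.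
apply/zariski_closedP; exists [set P ij.1 ij.2 | ij in setT].
apply/seteqP; split=> g /= Fg => [_ [ij _ <-]|]; first by rewrite evalP Fg mxE.
apply/matrixP=> i j; rewrite -evalP mxE; apply: Fg.
by exists (i, j).
Qed.

(** * The representation by right multiplications *)

Section RegularRepresentation.
Variables (R : comNzRingType) (S : algType R) (n : nat).
Variables (omega : 'I_n -> S) (t : S -> 'M[R]_n).
Hypothesis omega_basis : is_basis omega.
Hypothesis tE :
  forall alpha i, omega i * alpha = \sum_j t alpha j i *: omega j.

Definition lincomb (c : 'cV[R]_n) : S := \sum_j c j 0 *: omega j.

Lemma lincomb_bij : bijective lincomb.
Proof.
have /choice[u uP] x : exists c, lincomb c = x.
  have [c [-> _]] := omega_basis x.
  by exists c^T; apply: eq_bigr => j _; rewrite mxE.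
exists u => // c; have [r [_ runiq]] := omega_basis (lincomb c).
apply: trmx_inj; transitivity r; first apply: esym; apply: runiq.
- by rewrite -{1}(uP (lincomb c)); apply: eq_bigr => j _; rewrite mxE.
- by apply: eq_bigr => j _; rewrite mxE.
Qed.

Let lincomb_inj : injective lincomb := bij_inj lincomb_bij.

Lemma lincomb_surj x : exists c, lincomb c = x.
Proof. by case: lincomb_bij => u _ uK; exists (u x). Qed.

Lemma lincombD c d : lincomb (c + d) = lincomb c + lincomb d.
Proof.
by rewrite -big_split; apply: eq_bigr => j _; rewrite mxE scalerDl.
Qed.

Lemma lincombZ a c : lincomb (a *: c) = a *: lincomb c.
Proof.
by rewrite /lincomb scaler_sumr; apply: eq_bigr => j _; rewrite mxE scalerA.
Qed.

(** The defining relation of [t], read on coordinate columns; the other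
    properties of [t] are deduced from it through [mx_extP]. *)
Lemma lincombM c alpha : lincomb c * alpha = lincomb (t alpha *m c).
Proof.
rewrite /lincomb mulr_suml.
under eq_bigr do rewrite -scalerAl tE scaler_sumr.
rewrite exchange_big; apply: eq_bigr => j _; rewrite mxE scaler_suml.
by apply: eq_bigr => i _; rewrite scalerA mulrC.
Qed.

Lemma mx_extP (A B : 'M[R]_n) :
  (forall c, lincomb (A *m c) = lincomb (B *m c)) -> A = B.
Proof.
move=> eqAB; apply/matrixP=> i j.
suff : col j A = col j B by move/colP/(_ i); rewrite !mxE.
by rewrite !colE; apply/lincomb_inj/eqAB.
Qed.

Lemma tB : zmod_morphism t.
Proof.
move=> x y; apply: mx_extP => c; apply: (addIr (lincomb (t y *m c))).
by rewrite -[RHS]lincombD -mulmxDl subrK -!lincombM -mulrDr subrK.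
Qed.

Lemma tZ1 (r : R) : t r%:A = r%:M.
Proof.
by apply: mx_extP => c; rewrite -lincombM mulr_algr mul_scalar_mx lincombZ.
Qed.

Lemma t1 : t 1 = 1%:M.
Proof. by rewrite -tZ1 scale1r. Qed.

Lemma tM x y : t (x * y) = t y *m t x.
Proof. by apply: mx_extP => c; rewrite -lincombM mulrA !lincombM mulmxA. Qed.

Lemma t_inj : injective t.
Proof.
move=> x y eqt; have [e e1] := lincomb_surj 1.
by rewrite -[x]mul1r -[y]mul1r -e1 !lincombM eqt.
Qed.

(** If [gamma] denotes the image of [1] under the operator [M], then [M] and
    right multiplication by [gamma] agree at [1 * alpha] because [M] commutes
    with right multiplications and [S] is commutative. *)
Lemma commutant_t (M : 'M[R]_n) : (forall x y : S, x * y = y * x) ->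
  (forall alpha, M *m t alpha = t alpha *m M) -> exists gamma, M = t gamma.
Proof.
move=> SC Mt; have [e e1] := lincomb_surj 1.
exists (lincomb (M *m e)); apply: mx_extP => c.
rewrite -lincombM SC lincombM; congr lincomb; rewrite mulmxA -Mt -mulmxA.
by congr (_ *m _); apply: lincomb_inj; rewrite -lincombM e1 mul1r.
Qed.

(** With [e] the coordinates of [1], the column [M *m e] determines the only
    candidate [alpha] for [M = t alpha]. Hence [t S] is the set of solutions of
    the linear equation [M = \sum_j (M *m e) j 0 *: t (omega j)], an equation
    that makes sense over any extension of [R]. *)
Section Unit.
Variable e : 'cV[R]_n.
Hypothesis e1 : lincomb e = 1.

Lemma t_sum alpha : t alpha = \sum_j (t alpha *m e) j 0 *: t (omega j).
Proof.
have dE : lincomb (t alpha *m e) = alpha by rewrite -lincombM e1 mul1r.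
apply: mx_extP => c; rewrite mulmx_suml -lincombM -{1}dE [in LHS]/lincomb.
rewrite (big_morph lincomb lincombD (_ : lincomb 0 = 0)); last first.
  by apply: big1 => j _; rewrite mxE scale0r.
rewrite mulr_sumr.
by apply: eq_bigr => j _; rewrite -scalemxAl lincombZ -lincombM scalerAr.
Qed.

Lemma sum_in_t (M : 'M[R]_n) :
  M = \sum_j (M *m e) j 0 *: t (omega j) -> M = t (lincomb (M *m e)).
Proof.
move=> defM; rewrite t_sum {1}defM; apply: eq_bigr => j _.
congr (fun_of_matrix _ j 0 *: _); apply: lincomb_inj.
by rewrite -lincombM e1 mul1r.
Qed.

End Unit.
End RegularRepresentation.

(** * Subgroups between [T'] and its normalizer *)

Section NormalizerRigidity.
Variables (R : idomainType) (S : unitAlgType R) (n : nat).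
Variables (omega : 'I_n -> S) (t : S -> 'M[R]_n).
Hypothesis omega_basis : is_basis omega.
Hypothesis tE :
  forall alpha i, omega i * alpha = \sum_j t alpha j i *: omega j.
Variables (K : fieldType) (f : {rmorphism R -> K}).
Hypothesis f_inj : injective f.
Variable G : set (GL n R).
Hypothesis G_subgroup : subgroup G.
Hypothesis S_gen : additively_generated_by_units S.
Hypothesis Aut_finite : finite_set (Aut_over S).

Local Notation toK := (mapGL (n := n) f).

Definition torus : set (GL n R) :=
  [set g | exists2 alpha, alpha \is a GRing.unit & GL_mx g = t alpha].

Local Notation T' := (torus `&` G).
Local Notation T'0 := (connected_component (closure (toK @` T')) 1%g).

Hypothesis torus_span : forall g, torus g ->
  exists (m : nat) (c : 'I_m -> K) (h : 'I_m -> GL n K),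
    (forall i, T'0 (h i)) /\ GL_mx (toK g) = \sum_i c i *: GL_mx (h i).

Let tM := tM omega_basis tE.
Let t1 := t1 omega_basis tE.
Let tB := tB omega_basis tE.
Let tZ1 := tZ1 omega_basis tE.
Let t_inj := t_inj omega_basis tE.

Lemma map_mx_injective m p : injective (map_mx f : 'M_(m, p) -> 'M_(m, p)).
Proof.
move=> A B /matrixP eqAB; apply/matrixP=> i j.
by have := eqAB i j; rewrite !mxE => /f_inj.
Qed.

Lemma t_unitmx u : u \is a GRing.unit -> t u \in unitmx.
Proof.
by move=> Uu; case: (@mulmx1_unit _ _ (t u) (t u^-1)); rewrite // -tM mulVr.
Qed.

Lemma tV u : u \is a GRing.unit -> invmx (t u) = t u^-1.
Proof.
move=> Uu; apply: (can_inj (mulKmx (t_unitmx Uu))).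
by rewrite mulmxV ?t_unitmx // -tM mulVr.
Qed.

Lemma torus_subgroup : subgroup torus.
Proof.
split=> [|x y [a Ua xa] [b Ub yb]]; first by exists 1; rewrite ?unitr1 // t1.
exists (b^-1 * a); first by rewrite unitrMr ?unitrV.
by rewrite tM -tV // -xa -yb.
Qed.

Lemma T'_subgroup : subgroup T'.
Proof.
have [[T1 TV] [G1 GV]] := (torus_subgroup, G_subgroup).
by split=> // x y [Tx Gx] [Ty Gy]; split; [apply: TV | apply: GV].
Qed.

(** The elements [t u] with [u] a unit are combinations of elements of the
    component, and every [t alpha] is a difference of sums of such [t u]. *)
Lemma t_linear_vanish p q (F : 'M[K]_n -> 'M[K]_(p, q)) : linear F ->
  (forall c, T'0 c -> F (GL_mx c) = 0) ->
  forall alpha, F (map_mx f (t alpha)) = 0.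
Proof.
case/linear_bundle=> L -> L0.
apply: S_gen => [|x y Lx Ly|u Uu].
- have -> : t 0 = 0 by rewrite -(subrr 0) tB subrr.
  by rewrite map_mx0 linear0.
- by rewrite tB map_mxB linearB Lx Ly subrr.
have [|m [c [h [hT0 /= ->]]]] := torus_span (g := GL_of_mx (t_unitmx Uu)).
  by exists u.
by rewrite linear_sum big1 // => i _; rewrite linearZ /= L0 ?scaler0.
Qed.

(** The linear equation of [t S], pulled back by conjugation by [h], holds on
    [T'], hence on its closure, hence at [t alpha]; over [R] its solutions are
    again in [t S]. *)
Lemma conj_t h alpha : (forall x, T' x -> T' (x ^ h)%g) ->
  exists gamma, t alpha *m GL_mx h = GL_mx h *m t gamma.
Proof.
move=> hT'; have [e e1] := lincomb_surj omega_basis 1.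
pose F (M : 'M[K]_n) : 'M[K]_n :=
  let N := map_mx f (invmx (GL_mx h)) *m M *m map_mx f (GL_mx h) in
  N - \sum_j (N *m map_mx f e) j 0 *: map_mx f (t (omega j)).
have lF : linear F.
  move=> a u v; rewrite /F mulmxDr mulmxDl -scalemxAr -scalemxAl.
  rewrite scalerBr [RHS]addrACA -opprD scaler_sumr -big_split /=.
  congr (_ + _); congr (- _).
  by apply: eq_bigr => j _; rewrite mulmxDl -scalemxAl !mxE scalerDl scalerA.
have FE (M : 'M[R]_n) : let N := invmx (GL_mx h) *m M *m GL_mx h in
    F (map_mx f M) = map_mx f (N - \sum_j (N *m e) j 0 *: t (omega j)).
  rewrite /F /= -!map_mxM map_mxB; congr (_ + _); congr (- _).
  rewrite raddf_sum.
  by apply: eq_bigr => j _; rewrite /= map_mxZ mxE.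
have F0 : forall c, T'0 c -> F (GL_mx c) = 0.
  move=> c /connected_component_sub; move: c.
  apply: closure_sub; first exact: closed_linear.
  move=> _ [x T'x <-] /=; rewrite FE; have [[a _ xa] _] := hT' x T'x.
  rewrite [_ *m _](_ : _ = t a); last by rewrite -xa /= mulmxA.
  by rewrite -(t_sum omega_basis tE e1) subrr map_mx0.
have := t_linear_vanish lF F0 alpha.
rewrite FE -(map_mx0 f) => /map_mx_injective/eqP.
rewrite subr_eq0 => /eqP /(sum_in_t omega_basis tE e1) eqN.
exists (lincomb omega (invmx (GL_mx h) *m t alpha *m GL_mx h *m e)).
by rewrite -eqN -mulmxA mulKVmx ?Defs.GL_unitmx.
Qed.

Lemma normalizer_aut h : normalizer G T' h ->
  exists2 sigma, Aut_over S sigma &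
    forall alpha, t alpha *m GL_mx h = GL_mx h *m t (sigma alpha).
Proof.
move=> Nh; have hI := can_inj (mulKmx (Defs.GL_unitmx h)).
have /choice[s sP] alpha := conj_t alpha (fun x => normalizer_conj Nh (x := x)).
have /choice[s' s'P] alpha :=
  conj_t alpha (fun x => normalizer_conjV Nh (x := x)).
exists s => //; split.
- exists s' => alpha; apply: t_inj.
    apply: (can_inj (mulKmx (Defs.GL_unitmx h^-1%g))); rewrite -s'P /=.
    rewrite -[t (s alpha)](mulKmx (Defs.GL_unitmx h)) -sP.
    by rewrite !mulmxA mulmxK ?Defs.GL_unitmx.
  apply: hI; rewrite -sP.
  rewrite -[t (s' alpha)](mulKmx (Defs.GL_unitmx h^-1%g)) -s'P /=.
  by rewrite invmxK -!mulmxA mulVmx ?Defs.GL_unitmx // mulmx1.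
- by move=> x y; apply: t_inj; apply: hI; rewrite -sP !tB mulmxBl mulmxBr -!sP.
- split=> [|x y]; apply: t_inj; apply: hI; rewrite -sP.
    by rewrite t1 mulmx1 mul1mx.
  by rewrite !tM -mulmxA sP !mulmxA sP.
- by move=> r; apply: t_inj; apply: hI; rewrite -sP tZ1 scalar_mxC.
Qed.

(** Finitely many automorphisms leave no room for the connected component to
    act nontrivially: the [y] whose conjugate by [g] acts on [t S] through a
    given map form a closed set, and distinct maps give disjoint sets. *)
Lemma conj_t_comm g : (forall x, T' x -> normalizer G T' (x ^ g)%g) ->
  forall alpha beta, let N := invmx (GL_mx g) *m t beta *m GL_mx g in
  t alpha *m N = N *m t alpha.
Proof.
move=> gN alpha beta.
pose cj (M : 'M[K]_n) := map_mx f (invmx (GL_mx g)) *m M *m map_mx f (GL_mx g).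
have cjE x : cj (GL_mx (toK x)) = map_mx f (GL_mx (x ^ g)%g).
  by rewrite /cj -!map_mxM /= mulmxA.
pose F s a M := map_mx f (t a) *m cj M - cj M *m map_mx f (t (s a)).
have lF s a : linear (F s a).
  move=> c u v; rewrite /F /cj !(mulmxDr, mulmxDl) scalerBr opprD addrACA.
  by rewrite -!(scalemxAr, scalemxAl).
pose Z (s : S -> S) : set (GL n K) := [set y | forall a, F s a (GL_mx y) = 0].
have Zclosed s : closed (Z s).
  rewrite (_ : Z s = \bigcap_a [set y | F s a (GL_mx y) = 0]).
    by apply: closed_bigI => a _; apply: closed_linear.
  by apply/seteqP; split=> y Zy a; [move=> _ |]; apply: Zy.
have Zdisj s s' y : Z s y -> Z s' y -> s = s'.
  move=> Zs Zs'; apply/funext => a; apply: t_inj.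
  apply: map_mx_injective.
  apply: (can_inj (mulKmx (_ : cj (GL_mx y) \in unitmx))).
    rewrite !unitmx_mul Defs.GL_unitmx (Defs.GL_unitmx (toK g)).
    by rewrite (Defs.GL_unitmx (toK g^-1%g)).
  move: (Zs a) (Zs' a) => /eqP; rewrite subr_eq0 => /eqP <- /eqP.
  by rewrite subr_eq0 => /eqP.
have T'Z : closure (toK @` T') `<=` \bigcup_(s in Aut_over S) Z s.
  apply: closure_sub; first exact: closed_bigcup.
  move=> _ [x T'x <-]; have [s As sP] := normalizer_aut (gN x T'x).
  by exists s => // a; rewrite /F cjE -!map_mxM sP subrr.
have T'1 : closure (toK @` T') 1%g.
  apply: subset_closure; exists 1%g; first by case: T'_subgroup.
  by apply: val_inj; rewrite /= map_mx1.
have T'0Z : T'0 `<=` Z id.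
  apply: (connected_sub_piece (Z := Z) (i0 := id) (a := 1%g) Aut_finite) => //.
  - exact: component_connected.
  - by apply: subset_trans T'Z; apply: connected_component_sub.
  - exact: connected_component_refl.
  - move=> a; rewrite /F /cj /= mulmx1 -map_mxM mulVmx ?Defs.GL_unitmx //.
    by rewrite map_mx1 mulmx1 mul1mx subrr.
have /eqP := t_linear_vanish (lF id alpha) (fun c T'c => T'0Z c T'c alpha) beta.
rewrite subr_eq0 /cj -!map_mxM => /eqP; exact: map_mx_injective.
Qed.

(** [conj_t_comm] is used twice: at [g = 1] for the commutativity of [S], and
    at each [g] in [F] to place the conjugate of [t S] in the commutant of
    [t S], which is then [t S] itself. *)
Lemma normal_overgroup H F : Lat T' (normalizer G T') H ->
  Lat T' G F -> normal_in H F -> F `<=` normalizer G T'.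
Proof.
move=> [sH T'H HN] [sF T'F FG] [HF nHF].
have FN g : F g -> forall x, T' x -> normalizer G T' (x ^ g)%g.
  by move=> Fg x T'x; apply: HN; apply: nHF => //; apply: T'H.
have SC x y : x * y = y * x :> S.
  have /= := conj_t_comm (FN _ sF.1) y x.
  by rewrite invmx1 mul1mx mulmx1 -!tM => /t_inj.
have conjT g beta : F g ->
    exists gamma, invmx (GL_mx g) *m t beta *m GL_mx g = t gamma.
  move=> Fg; apply: (commutant_t omega_basis tE SC) => alpha.
  by rewrite conj_t_comm //; apply: FN.
have T'J g x : F g -> T' x -> T' (x ^ g)%g.
  move=> Fg [[b Ub xb] Gx]; split; last by apply: subgroupJ => //; apply: FG.
  have [c cE] := conjT g b Fg; have [c' c'E] := conjT g b^-1 Fg.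
  exists c; last by rewrite /= -cE xb mulmxA.
  have c1 : c' * c = 1.
    (* conjugation by g is multiplicative, so units go to units *)
    apply: t_inj; rewrite tM -cE -c'E t1 -!mulmxA mulKVmx ?Defs.GL_unitmx //.
    by rewrite (mulmxA (t b)) -tM mulVr // t1 mul1mx mulVmx ?Defs.GL_unitmx.
  by apply/unitrP; exists c'; rewrite c1 SC c1.
move=> g Fg; split; first exact: FG.
by case: (conj_sub_normalizer sF Fg (H := T')).
Qed.

End NormalizerRigidity.

Theorem theorem4p2 (R : idomainType) (S : unitAlgType R) (n : nat)
    (omega : 'I_n -> S) (omega_basis : is_basis omega)
    (t : S -> 'M[R]_n)
    (tE : forall alpha i, omega i * alpha = \sum_j t alpha j i *: omega j)
    (kbar : closedFieldType) (iota : {rmorphism {fraction R} -> kbar})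
    (kbar_algebraic : forall x : kbar, algebraicOver iota x)
    (Gt : set (GL n kbar)) (Gt_subgroup : subgroup Gt) (Gt_closed : closed Gt) :
  let toK : GL n R -> GL n kbar := mapGL (iota \o @tofrac R) in
  let T : set (GL n R) :=
    [set g | exists2 alpha, alpha \is a GRing.unit & GL_mx g = t alpha] in
  let G' : set (GL n R) := toK @^-1` Gt in
  let T' : set (GL n R) := T `&` G' in
  additively_generated_by_units S ->
  finite_set (Aut_over S) ->
  (forall g, closure (toK @` T) g ->
    exists (m : nat) (c : 'I_m -> kbar) (h : 'I_m -> GL n kbar),
      (forall i, connected_component (closure (toK @` T')) 1%g (h i)) /\
      GL_mx g = \sum_i c i *: GL_mx (h i)) ->
  lower_garland T' G' = Lat T' (normalizer G' T').
Proof.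
move=> toK T G' T' S_gen Aut_finite T_span.
have f_inj : injective (iota \o @tofrac R).
  by move=> x y /fmorph_inj/eqP; rewrite tofrac_eq => /eqP.
have G'_subgroup : subgroup G'.
  have toK1 : toK 1%g = 1%g by apply: val_inj; rewrite /= map_mx1.
  have toKM x y : toK (x * y)%g = (toK x * toK y)%g.
    by apply: val_inj; rewrite /= map_mxM.
  have toKMV x y : toK (x * y^-1)%g = (toK x * (toK y)^-1)%g.
    by apply: (can_inj (mulgK (toK y))); rewrite -toKM !mulgVK.
  case: Gt_subgroup => G1 GMV; split; first by rewrite /G' /= toK1.
  by move=> x y Gx Gy; rewrite /G' /= toKMV; apply: GMV.
have T_unit_span g : T g ->
    exists (m : nat) (c : 'I_m -> kbar) (h : 'I_m -> GL n kbar),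
    (forall i, connected_component (closure (toK @` T')) 1%g (h i)) /\
    GL_mx (toK g) = \sum_i c i *: GL_mx (h i).
  by move=> Tg; apply: T_span; apply: subset_closure; exists g.
apply: lower_garland_eq; first exact: T'_subgroup.
  by move=> x [].
exact: normal_overgroup T_unit_span.
Qed.
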